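(* Let $F$ be any $4$-regular graph and let $\widetilde{F}$ be any embedding of $F$ (i.e. any embedded graph whose underlying abstract graph is $F$). Then the set of cycle family graphs of $\widetilde{F}$ is precisely the set of all embedded graphs $G$ such that $G_m$ and $F$ are isomorphic as abstract graphs: $$\mathcal{C}(\widetilde{F})=\{G \mid G_m\cong\widetilde{F}\}=\{G\mid G_m\cong F\}.$$
   Context: Embedded graphs. An embedded graph is a finite graph (loops and multiple edges allowed) cellularly embedded in a closed, possibly non-orientable, surface. Equivalently, it is a ribbon graph: a surface with boundary that is a union of vertex discs and edge discs, meeting in disjoint line segments, each segment on the boundary of exactly one vertex disc and one edge disc, each edge disc containing exactly two segments. Equivalently, it is an arrow presentation: a set of circles with disjoint labelled arrows on them, each label appearing on exactly two arrows, up to relabelling pairs and reversing both arrows of a given label. Circles correspond to vertex discs; for each label $e$ an edge disc is attached by orienting its boundary, choosing two disjoint boundary arcs directed accordingly, and identifying these with the two $e$-labelled arrows respecting directions. Embedded graphs are considered up to isomorphism (homeomorphism preserving the vertex-edge structure). The symbol $\cong$ denotes isomorphism of underlying abstract graphs (forgetting the embedding). Medial graphs. The medial graph $G_m$ of a cellularly embedded graph $G$ is the 4-regular embedded graph in the same surface with a vertex $v_e$ of degree 4 on each edge $e$ of $G$ and edges drawn by following the face boundaries of $G$. (By convention an isolated vertex of $G$ gives an isolated face in $G_m$.) Cycle family graphs. Let $F$ be a 4-regular embedded graph. A vertex state at $v$ is a choice of one of the three pairings of the four half-edges at $v$, where $v$ is replaced by two arcs joining the paired half-edges. An arrow marked vertex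 state is a vertex state with one $v$-labelled arrow on each of the two arcs, each pointing in either direction. An arrow marked graph state $\vec{s}$ is a choice of arrow marked vertex state at each vertex. The resulting closed curves with their arrows form an arrow presentation, whose embedded graph is denoted $F_{\vec{s}}$ and called a cycle family graph of $F$. $\mathcal{C}(F)$ is the set of all cycle family graphs of $F$. *)

(* Defs.v *)
From mathcomp Require Import all_boot.

Set Implicit Arguments.
Unset Strict Implicit.
Unset Printing Implicit Defensive.

(* Finite graphs with loops and multiple edges, given by half-edges: an edge is
   a pair [{h, opp h}] and [base h] is the vertex at which [h] is attached (so
   a loop contributes two half-edges to its vertex).  [isoface] counts
   components with neither vertices nor edges: they arise only because the
   medial graph of an isolated vertex is, by convention, an isolated face. *)
Record mgraph := MGraph {
  vert : finType;
  hedge : finType;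
  base : hedge -> vert;
  opp : hedge -> hedge;
  isoface : nat;
  oppK : involutive opp;
  opp_neq : forall h, opp h != h }.

Definition degree (F : mgraph) (v : vert F) : nat :=
  #|[set h : hedge F | base h == v]|.

Definition regular (d : nat) (F : mgraph) : Prop :=
  forall v : vert F, degree v = d.

Definition graph_iso (A B : mgraph) : Prop :=
  exists (fv : vert A -> vert B) (fh : hedge A -> hedge B),
    [/\ bijective fv, bijective fh,
        forall h, base (fh h) = fv (base h),
        forall h, opp (fh h) = fh (opp h)
      & isoface A = isoface B].

(* Ribbon graphs.  A flag is one of the four corners of an edge disc, i.e. an
   endpoint of one of the line segments where an edge disc meets a vertex disc.
   - [r0 x] is joined to [x] along a free side of the edge disc;
   - [r1 x] is joined to [x] along an arc of the boundary of the vertex disc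
     that meets no edge disc;
   - [r2 x] is the other endpoint of the line segment at [x].
   In the cellularly embedded graph, [x] is a (vertex, edge, face) triangle of
   the barycentric subdivision, and [r0], [r1], [r2] change only the vertex,
   the edge, the face.  Orientability and connectedness are not required.  A
   vertex disc that meets no edge disc has no flags, so these discs, the
   isolated vertices, are merely counted by [isovert]. *)
Record embgraph := EmbGraph {
  flag : finType;
  r0 : flag -> flag;
  r1 : flag -> flag;
  r2 : flag -> flag;
  isovert : nat;
  r0K : involutive r0;
  r1K : involutive r1;
  r2K : involutive r2;
  r0_neq : forall x, r0 x != x;
  r1_neq : forall x, r1 x != x;
  r2_neq : forall x, r2 x != x;
  r02C : forall x, r0 (r2 x) = r2 (r0 x);
  r02_neq : forall x, r0 x != r2 x }.

Definition emb_iso (G H : embgraph) : Prop :=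
  exists f : flag G -> flag H,
    [/\ bijective f,
        forall x, f (r0 x) = r0 (f x),
        forall x, f (r1 x) = r1 (f x),
        forall x, f (r2 x) = r2 (f x)
      & isovert G = isovert H].

(* An embedded graph together with [nisoface] isolated faces: this is the kind
   of object to which medial graphs belong. *)
Record femb := FEmb {
  femb_graph :> embgraph;
  nisoface : nat }.

Section Underlying.

Variable G : embgraph.

(* The half-edge at a flag, as the set of ends of a line segment. *)
Definition hset (x : flag G) : {set flag G} := [set x; r2 x].

(* The vertex at a flag, as the set of flags around a vertex disc. *)
Definition vset (x : flag G) : {set flag G} :=
  [set y | connect [rel a b | (b == r1 a) || (b == r2 a)] x y].

Definition halfedge : finType := {h : {set flag G} | h \in codom hset}.
Definition flagvertex : finType := {v : {set flag G} | v \in codom vset}.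

Lemma hset_r0 (x : flag G) : @r0 G @: hset x = hset (r0 x).
Proof. by rewrite /hset imsetU1 imset_set1 r02C. Qed.

Lemma hset_vset (x : flag G) : \bigcup_(y in hset x) vset y = vset x.
Proof.
have sub2 a : vset (r2 a) \subset vset a.
  apply/subsetP=> y; rewrite !inE; apply: connect_trans.
  by apply: connect1; rewrite /= eqxx orbT.
rewrite /hset bigcup_setU !big_set1.
by apply/setUidPl.
Qed.

Lemma halfedge_opp_subproof (h : halfedge) : @r0 G @: val h \in codom hset.
Proof. by case: h => h /= /codomP[x ->]; rewrite hset_r0 codom_f. Qed.

Lemma halfedge_base_subproof (h : halfedge) :
  \bigcup_(y in val h) vset y \in codom vset.
Proof. by case: h => h /= /codomP[x ->]; rewrite hset_vset codom_f. Qed.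

Definition halfedge_opp (h : halfedge) : halfedge :=
  exist _ (@r0 G @: val h) (halfedge_opp_subproof h).

Definition halfedge_base (h : halfedge) : (flagvertex + 'I_(isovert G))%type :=
  inl (exist _ (\bigcup_(y in val h) vset y) (halfedge_base_subproof h)).

Lemma halfedge_oppK : involutive halfedge_opp.
Proof.
move=> h; apply: val_inj => /=; rewrite -imset_comp.
by rewrite (eq_imset _ (@r0K G)) imset_id.
Qed.

Lemma halfedge_opp_neq h : halfedge_opp h != h.
Proof.
rewrite -val_eqE /=; case: h => h /= /codomP[x ->]; rewrite hset_r0.
apply/eqP=> /setP/(_ (r0 x)); rewrite !inE eqxx /=.
by rewrite (negPf (r0_neq x)) (negPf (r02_neq x)).
Qed.

End Underlying.

Definition underlying (E : femb) : mgraph :=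
  @MGraph (flagvertex E + 'I_(isovert E))%type (halfedge E)
    (@halfedge_base E) (@halfedge_opp E) (nisoface E)
    (@halfedge_oppK E) (@halfedge_opp_neq E).

(* In the triangle [x] of the barycentric subdivision of [G], with corners [v],
   [e], [f], the medial graph is a segment from [e] to the side [vf]; it splits
   the triangle into the medial flags [(x, true)], on the side of the vertex
   [v], and [(x, false)], on the side of the face [f].  The medial edge through
   [x] crosses [vf] into [r1 x].  Around the medial vertex [e], one leaves [x]
   through its side [ve] into [r2 x], or through its side [fe] into [r0 x]. *)
Section Medial.

Variable G : embgraph.

Let mflag : finType := (flag G * bool)%type.

Definition med0 (x : mflag) : mflag := (r1 x.1, x.2).
Definition med1 (x : mflag) : mflag := (if x.2 then r2 x.1 else r0 x.1, x.2).
Definition med2 (x : mflag) : mflag := (x.1, ~~ x.2).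

Lemma med0K : involutive med0.
Proof. by case=> x b; rewrite /med0 /= r1K. Qed.

Lemma med1K : involutive med1.
Proof. by case=> x []; rewrite /med1 /= ?r0K ?r2K. Qed.

Lemma med2K : involutive med2.
Proof. by case=> x b; rewrite /med2 /= negbK. Qed.

Lemma med0_neq x : med0 x != x.
Proof. by case: x => x b; rewrite xpair_eqE (negPf (r1_neq x)). Qed.

Lemma med1_neq x : med1 x != x.
Proof.
by case: x => x []; rewrite xpair_eqE /= ?(negPf (r2_neq x)) ?(negPf (r0_neq x)).
Qed.

Lemma med2_neq x : med2 x != x.
Proof. by case: x => x []; rewrite xpair_eqE andbF. Qed.

Lemma med02C x : med0 (med2 x) = med2 (med0 x).
Proof. by []. Qed.

Lemma med02_neq x : med0 x != med2 x.
Proof. by case: x => x []; rewrite xpair_eqE andbF. Qed.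

Definition medial : femb :=
  FEmb (@EmbGraph mflag med0 med1 med2 0
          med0K med1K med2K med0_neq med1_neq med2_neq med02C med02_neq)
       (isovert G).

End Medial.

(* Arrow presentations, described by the ends (tail and head) of their arrows:
   [across x] is the other end of the arrow with end [x], [along x] is the
   arrow end reached from [x] along its circle, away from its arrow, and
   [ishead] tells the heads.  The circles are the orbits of [across] and
   [along], plus [bare] circles carrying no arrow.  Counting the heads with
   label [l] counts the [l]-labelled arrows. *)
Record arrow_presentation := ArrowPresentation {
  aend : finType;
  label_type : finType;
  across : aend -> aend;
  along : aend -> aend;
  ishead : aend -> bool;
  label : aend -> label_type;
  bare : nat;
  acrossK : involutive across;
  alongK : involutive along;
  along_neq : forall x, along x != x;
  ishead_across : forall x, ishead (across x) = ~~ ishead x;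
  label_across : forall x, label (across x) = label x;
  label_twice : forall l, #|[set x | ishead x & label x == l]| = 2 }.

Section EmbOfArrows.

Variable P : arrow_presentation.

(* The free sides of the edge disc labelled [l] join the head of each of the
   two [l]-labelled arrows to the tail of the other one. *)
Definition sidepred (x : aend P) : pred (aend P) :=
  [pred y | [&& label y == label x, ishead y == ~~ ishead x & y != across x]].

Definition side (x : aend P) : aend P := odflt x [pick y | sidepred x y].

Lemma across_neq (x : aend P) : across x != x.
Proof. by apply/eqP=> e; move: (ishead_across x); rewrite e; case: ishead. Qed.

Lemma card_label (l : label_type P) b :
  #|[set x : aend P | ishead x == b & label x == l]| = 2.
Proof.
case: b; first by rewrite -(label_twice l); apply: eq_card => x; rewrite !inE eqb_id.
rewrite -(label_twice l) -(card_imset _ (can_inj (@acrossK P))).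
apply: eq_card => x; rewrite !inE; apply/imsetP/andP => [[y]|[hx /eqP lx]].
  by rewrite !inE => /andP[/eqP hy /eqP ly] ->; rewrite ishead_across hy label_across ly.
exists (across x); last by rewrite acrossK.
by rewrite !inE ishead_across hx label_across lx !eqxx.
Qed.

Lemma side_ex_uniq (x : aend P) : #|sidepred x| = 1.
Proof.
have := card_label (label x) (~~ ishead x).
rewrite (cardsD1 (across x)) !inE ishead_across label_across !eqxx /= => -[<-].
by apply: eq_card => y; rewrite !inE; case: (_ == _); case: (_ == _); case: (_ == _).
Qed.

Lemma sideP (x y : aend P) : sidepred x y = (y == side x).
Proof.
have [z hz] := mem_card1 (side_ex_uniq x).
have e w : sidepred x w = (w == z) by have := hz w; rewrite !inE.
rewrite /side; case: pickP => [w|/(_ z)]; rewrite e ?eqxx // => /eqP ->.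
exact: e.
Qed.

Lemma side_prop x :
  [/\ label (side x) = label x, ishead (side x) = ~~ ishead x & side x != across x].
Proof. by have:= sideP x (side x); rewrite eqxx => /and3P[/eqP-> /eqP->]. Qed.

Lemma sideK : involutive side.
Proof.
move=> x; apply/esym/eqP; rewrite -sideP /sidepred /=.
have [-> -> n] := side_prop x; rewrite negbK !eqxx /=.
by apply: contraNneq n => {2}->; rewrite acrossK.
Qed.

Lemma side_neq x : side x != x.
Proof.
have [_ e _] := side_prop x.
by apply/eqP=> e'; move: e; rewrite e'; case: ishead.
Qed.

Lemma side_acrossC x : side (across x) = across (side x).
Proof.
apply/esym/eqP; rewrite -sideP /sidepred /= !label_across !ishead_across acrossK.
have [-> -> n] := side_prop x; rewrite !eqxx /=.
by apply: contraNneq n => e; rewrite -{2}e acrossK.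
Qed.

Lemma side_across_neq x : side x != across x.
Proof. by have [] := side_prop x. Qed.

Definition emb_of_arrows : embgraph :=
  @EmbGraph (aend P) side (@along P) (@across P) (bare P)
    sideK (@alongK P) (@acrossK P) side_neq (@along_neq P) across_neq
    side_acrossC side_across_neq.

End EmbOfArrows.

(* An arrow marked graph state of [F].  At each vertex [v], [pairing] restricts
   to a pairing of the half-edges at [v], and [towards h] says that the arrow
   on the arc joining [h] to [pairing h] points towards [h]. *)
Record marked_state (F : femb) := MarkedState {
  pairing : hedge (underlying F) -> hedge (underlying F);
  towards : hedge (underlying F) -> bool;
  pairingK : involutive pairing;
  pairing_neq : forall h, pairing h != h;
  pairing_base : forall h, base (pairing h) = base h;
  towards_pairing : forall h, towards (pairing h) = ~~ towards h }.

Section CycleFamily.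

Variables (F : femb) (F4 : regular 4 (underlying F)) (s : marked_state F).

Lemma state_label_twice (v : vert (underlying F)) :
  #|[set h | towards s h & base h == v]| = 2.
Proof.
pose A := [set h | base h == v]; pose B := [set h | towards s h].
have eT : [set h | towards s h & base h == v] = A :&: B.
  by apply/setP=> h; rewrite !inE andbC.
have eF : pairing s @: (A :&: B) = A :\: B.
  apply/setP=> h; rewrite !inE; apply/imsetP/andP => [[g]|[nh bh]].
    by rewrite !inE => /andP[bg tg] ->; rewrite towards_pairing tg pairing_base.
  exists (pairing s h); last by rewrite pairingK.
  by rewrite !inE towards_pairing nh pairing_base bh.
have := F4 v; rewrite /degree -/A -(cardsID B A) -eF.
rewrite (card_imset _ (can_inj (@pairingK _ s))) eT.
by rewrite addnn -[4]/(2.*2) => /double_inj.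
Qed.

(* The arrow ends are the half-edges of [F]: the arrow of the arc from [h] to
   [pairing h] runs between these two, the edges of [F] join consecutive arrows
   on the circles, and arrows are labelled by the vertices of [F].  An isolated
   face of [F] yields a circle without arrows. *)
Definition state_arrows : arrow_presentation :=
  @ArrowPresentation (hedge (underlying F)) (vert (underlying F))
    (pairing s) (@opp (underlying F)) (towards s) (@base (underlying F))
    (isoface (underlying F))
    (@pairingK F s) (@oppK (underlying F)) (@opp_neq (underlying F))
    (@towards_pairing F s) (@pairing_base F s) state_label_twice.

Definition cycle_family_graph : embgraph := emb_of_arrows state_arrows.

End CycleFamily.

(* Embedded graphs are considered up to isomorphism. *)
Definition cycle_family (F : femb) (F4 : regular 4 (underlying F))
    (G : embgraph) : Prop :=
  exists s : marked_state F, emb_iso G (cycle_family_graph F4 s).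

Lemma regular_iso (d : nat) (A B : mgraph) :
  graph_iso A B -> regular d B -> regular d A.
Proof.
case=> fv [fh [fvb fhb fbase _ _]] Br v.
rewrite -(Br (fv v)) /degree -(card_imset _ (bij_inj fhb)).
apply: eq_card => h; rewrite inE; apply/imsetP/eqP => [[g]|].
  by rewrite inE => /eqP <- ->; rewrite fbase.
case: fhb => gh _ fhK bh; exists (gh h); last by rewrite fhK.
by rewrite inE -(inj_eq (bij_inj fvb)) -fbase fhK bh.
Qed.

(* Main.v *)
Require Import Defs.
From mathcomp Require Import all_boot.

(** The half-edges of the medial graph of [G] correspond to the flags of [G]:
    the medial edge through a flag [x] crosses into [r1 x], and the medial
    vertex at its end is the edge of [G] containing [x], that is, the class
    [edge_flags x] of the four flags reached by [r0] and [r2].  Hence an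
    isomorphism from [G_m] to a graph [B] without isolated vertices is the same
    thing as a bijection from the flags of [G] to the half-edges of [B] that
    turns [r1] into [opp] and the partition into edges of [G] into the
    partition into stars of [B] ([medial_isoP]); besides, the isolated vertices
    of [G] must be as many as the isolated faces of [B].  The involutions [r0]
    and [r2] are seen only through the partition that they generate.

    On the other side, the flags of a cycle family graph of [B] are by
    construction the half-edges of [B], with [r1] equal to [opp], and with [r2]
    (the pairing) and [r0] preserving the base.  Since both an edge of a ribbon
    graph and a star of a 4-regular graph have four elements, the two
    partitions agree, so that its medial graph is [B].  Conversely, along a
    bijection as above, [r2] can be transported to a pairing of the half-edges
    of [B], and it remains to mark the arrows so that the free sides of the
    edge discs are given by [r0].  This asks for a marking which changes under
    both [r0] and [r2]; one exists because these involutions act freely, as a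
    Klein four-group, on each edge ([arrow_head]).

    The condition on [G_m] sees only the abstract graph, so the second equality
    is a composition of isomorphisms. *)

Set Implicit Arguments.
Unset Strict Implicit.
Unset Printing Implicit Defensive.

(** * Isomorphisms of abstract graphs *)

Lemma graph_iso_sym (A B : mgraph) : graph_iso A B -> graph_iso B A.
Proof.
case=> fv [fh [[gv fvK gvK] [gh fhK ghK] fb fo iso]].
exists gv, gh; split=> [||h|h|].
- by exists fv.
- by exists fh.
- by rewrite -[h in LHS]ghK -[h in RHS]ghK fb fvK fhK.
- by rewrite -{2}(ghK h) fo fhK.
- by [].
Qed.

Lemma graph_iso_trans (A B C : mgraph) :
  graph_iso A B -> graph_iso B C -> graph_iso A C.
Proof.
case=> fv [fh [fvb fhb fb fo iso]] [gv [gh [gvb ghb gb go iso']]].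
exists (gv \o fv), (gh \o fh); split=> [||h|h|] /=.
- exact: bij_comp.
- exact: bij_comp.
- by rewrite gb fb.
- by rewrite go fo.
- by rewrite iso.
Qed.

Lemma bij_of_inj_surj (A : choiceType) (B : eqType) (f : A -> B) :
  injective f -> (forall b, exists a, f a == b) -> bijective f.
Proof.
move=> finj fsurj; pose g b := xchoose (fsurj b).
have gK : cancel g f by move=> b; apply/eqP/(xchooseP (fsurj b)).
by exists g => // a; apply: finj; rewrite gK.
Qed.

(** When no vertex is isolated, vertices can be recovered as classes of
    half-edges, so the vertex part of an isomorphism comes for free. *)
Lemma graph_iso_of_hedges (A B : mgraph) (f : hedge A -> hedge B) :
  (forall v : vert A, exists h, base h == v) ->
  (forall w : vert B, exists h, base h == w) ->
  bijective f ->
  (forall h k, base (f h) = base (f k) <-> base h = base k) ->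
  (forall h, opp (f h) = f (opp h)) ->
  isoface A = isoface B ->
  graph_iso A B.
Proof.
move=> Asurj Bsurj fbij fbase fopp iso.
pose fv v := base (f (xchoose (Asurj v))).
have fvE h : base (f h) = fv (base h).
  by apply/fbase/esym/eqP/(xchooseP (Asurj (base h))).
exists fv, f; split=> //; apply: bij_of_inj_surj => [v w|w].
  have [h /eqP <-] := Asurj v; have [k /eqP <-] := Asurj w.
  by rewrite -!fvE => /fbase.
have [k /eqP <-] := Bsurj w; have [g _ gK] := fbij.
by exists (base (g k)); rewrite -fvE gK.
Qed.

(** * The edges of a ribbon graph as orbits of flags *)

Section EdgeFlags.

Variable G : embgraph.
Implicit Types x y : flag G.

Definition edge_flags x : {set flag G} :=
  x |: (r0 x |: (r2 x |: [set r0 (r2 x)])).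

Lemma edge_flags_refl x : x \in edge_flags x.
Proof. by rewrite !inE eqxx. Qed.

Lemma edge_flags_r0 x : edge_flags (r0 x) = edge_flags x.
Proof.
apply/setP=> y; rewrite !inE -r02C !r0K.
by case: (y == x); case: (y == r0 x); case: (y == r2 x); case: (y == _).
Qed.

Lemma edge_flags_r2 x : edge_flags (r2 x) = edge_flags x.
Proof.
apply/setP=> y; rewrite !inE r2K.
by case: (y == x); case: (y == r0 x); case: (y == r2 x); case: (y == _).
Qed.

Lemma edge_flagsE x y : (y \in edge_flags x) = (edge_flags y == edge_flags x).
Proof.
apply/idP/eqP=> [|<-]; last exact: edge_flags_refl.
by rewrite !inE => /or4P[]/eqP->; rewrite ?edge_flags_r0 ?edge_flags_r2.
Qed.

Lemma r0r2_neq x : r0 (r2 x) != x.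
Proof. by rewrite (can2_eq (@r0K G) (@r0K G)) eq_sym r02_neq. Qed.

Lemma card_edge_flags x : #|edge_flags x| = 4.
Proof.
rewrite /edge_flags !cardsU1 cards1 !inE.
rewrite (eq_sym x) (negPf (r0_neq x)) (eq_sym x) (negPf (r2_neq x)).
rewrite (eq_sym x) (negPf (r0r2_neq x)) (negPf (r02_neq x)).
rewrite (inj_eq (can_inj (@r0K G))) (eq_sym x) (negPf (r2_neq x)).
by rewrite (eq_sym (r2 x)) (negPf (r0_neq _)).
Qed.

(* The default value is never used, so the choice depends on the edge only. *)
Definition edge_root x : flag G := odflt x [pick y in edge_flags x].

Lemma edge_root_in x : edge_root x \in edge_flags x.
Proof.
by rewrite /edge_root; case: pickP => //= /(_ x); rewrite edge_flags_refl.
Qed.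

Lemma edge_root_eq x y :
  edge_flags x = edge_flags y -> edge_root x = edge_root y.
Proof.
rewrite /edge_root => ->; case: pickP => //= /(_ y).
by rewrite edge_flags_refl.
Qed.

(** Of the four corners of an edge disc, the chosen one and the one diagonally
    across are heads.  Going from a corner to a neighbouring one, along a free
    side or along a segment on a vertex disc, then exchanges heads and tails. *)
Definition arrow_head x : bool :=
  (edge_root x == x) || (edge_root x == r0 (r2 x)).

Lemma arrow_head_r0 x : arrow_head (r0 x) = ~~ arrow_head x.
Proof.
rewrite /arrow_head (edge_root_eq (edge_flags_r0 x)) -r02C r0K.
have := edge_root_in x; rewrite !inE => /or4P[]/eqP->.
- rewrite eqxx [x == r0 x]eq_sym (negPf (r0_neq x)).
  by rewrite [x == _]eq_sym (negPf (r2_neq x)).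
- rewrite eqxx (negPf (r0_neq x)) (inj_eq (can_inj (@r0K G))).
  by rewrite [x == _]eq_sym (negPf (r2_neq x)).
- rewrite eqxx orbT (negPf (r2_neq x)).
  by rewrite [_ == r0 _]eq_sym (negPf (r0_neq _)).
- rewrite eqxx orbT (inj_eq (can_inj (@r0K G))) (negPf (r2_neq x)).
  by rewrite (negPf (r0_neq _)).
Qed.

Lemma arrow_head_r2 x : arrow_head (r2 x) = ~~ arrow_head x.
Proof.
(* The diagonal of the edge disc preserves heads, so [r2] acts on them as
   [r0]. *)
rewrite -arrow_head_r0 /arrow_head (edge_root_eq (edge_flags_r0 x)).
by rewrite (edge_root_eq (edge_flags_r2 x)) r2K -r02C r0K orbC.
Qed.

End EdgeFlags.

(** * The medial graph in terms of flags *)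

Section MedialHalfedges.

Variable G : embgraph.
Implicit Types x y : flag G.

Local Notation M := (underlying (medial G)).

Definition medial_hedge x : hedge M :=
  exist _ (@hset (medial G) (x, true)) (codom_f _ _).

Lemma medial_hedge_bij : bijective medial_hedge.
Proof.
apply: bij_of_inj_surj => [x y /(congr1 val)/setP/(_ (x, true))|h].
  by rewrite !inE !xpair_eqE eqxx /= !andbT andbF orbF => /esym/eqP.
case: h => h hP; have /codomP[[x b] hE] := hP.
exists x; rewrite -val_eqE /= hE; case: b {hE} => //.
by rewrite /hset setUC.
Qed.

Lemma opp_medial_hedge x : opp (medial_hedge x) = medial_hedge (r1 x).
Proof. by apply: val_inj; apply: (@hset_r0 (medial G)). Qed.

(** The bit of a medial flag only tells on which side of the medial edge one
    stands, and both sides are visited around a medial vertex; this lets [med1]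
    realise [r2] and [r0] alike. *)
Lemma medial_vset (p : flag (medial G)) :
  vset p = [set q : flag (medial G) | edge_flags q.1 == edge_flags p.1].
Proof.
apply/setP=> q; rewrite !inE; apply/idP/idP=> [/connectP[s]|].
  elim: s p q => [|a s IHs] p q /=; first by move=> _ ->.
  case/andP=> pa sP qE; rewrite (eqP (IHs _ _ sP qE)).
  case/orP: pa => /eqP-> //=.
  by case: (p.2); rewrite ?edge_flags_r0 ?edge_flags_r2.
(* The link of the medial vertex is walked by leaving [(x, true)] into
   [(r2 x, true)], leaving [(x, false)] into [(r0 x, false)], and crossing the
   medial edge at will. *)
set e := (X in connect X).
have flip (a : flag (medial G)) : connect e a (a.1, ~~ a.2).
  by apply: connect1; rewrite /e /= eqxx orbT.
have lift x b c : connect e (x, b) (x, c).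
  have [->|] := eqVneq b c; first exact: connect0.
  by move=> nbc; have -> : c = ~~ b; [case: b c nbc => [] [] | exact: flip].
have to_r2 x b c : connect e (x, b) (r2 x, c).
  apply: connect_trans (lift x b true) _.
  apply: connect_trans (lift (r2 x) true c).
  by apply: connect1; rewrite /e /= eqxx.
have to_r0 x b c : connect e (x, b) (r0 x, c).
  apply: connect_trans (lift x b false) _.
  apply: connect_trans (lift (r0 x) false c).
  by apply: connect1; rewrite /e /= eqxx.
case: p q => [x b] [y c] /=; rewrite -edge_flagsE !inE => /or4P[]/eqP-> //.
exact: connect_trans (to_r2 x b true) (to_r0 _ _ _).
Qed.

Lemma base_medial_hedge x y :
  base (medial_hedge x) = base (medial_hedge y) <->
  edge_flags x = edge_flags y.
Proof.
have bE z : \bigcup_(q in @hset (medial G) (z, true)) vset q =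
  [set q : flag (medial G) | edge_flags q.1 == edge_flags z].
  by rewrite hset_vset medial_vset.
split=> [[]|exy].
  by rewrite !bE => /setP/(_ (x, true)); rewrite !inE eqxx => /esym/eqP.
by congr inl; apply: val_inj; rewrite /= !bE exy.
Qed.

Lemma base_medial_surj (v : vert M) : exists h : hedge M, base h == v.
Proof.
case: v => [[v vP]|[]//]; have /codomP[p vE] := vP.
exists (medial_hedge p.1); apply/eqP; congr inl; apply: val_inj.
by apply: etrans (@hset_vset (medial G) _) _; rewrite /= vE !medial_vset.
Qed.

(** The medial graph has no isolated vertex, and its half-edges are the flags
    of [G]; so the isomorphisms out of it are certain bijections on flags, in
    which [r0] and [r2] matter only through the edges that they generate.  This
    freedom is what the choice of a marked state accounts for. *)
Lemma medial_isoP (B : mgraph) :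
  graph_iso M B <->
  exists f : flag G -> hedge B,
    [/\ bijective f,
        forall x, opp (f x) = f (r1 x),
        forall x y, base (f x) = base (f y) <-> edge_flags x = edge_flags y,
        forall w : vert B, exists h, base h == w
      & isovert G = isoface B].
Proof.
split=> [[fv [fh [fvb fhb fb fo iso]]]|[f [fbij fo fb Bsurj iso]]].
  exists (fh \o medial_hedge); split=> // [|x|x y|w] /=.
  - exact: bij_comp medial_hedge_bij.
  - by rewrite fo opp_medial_hedge.
  - apply: iff_trans (base_medial_hedge x y); rewrite !fb.
    by split=> [/(bij_inj fvb)|->].
  have [gv _ gvK] := fvb; have [h /eqP hE] := base_medial_surj (gv w).
  by exists (fh h); rewrite fb hE gvK.
have [g mK gK] := medial_hedge_bij.
apply: (@graph_iso_of_hedges _ _ (f \o g)) => // [||h k|h] /=.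
- exact: base_medial_surj.
- by apply: bij_comp; last exists medial_hedge.
- apply: iff_trans (fb _ _) _; apply: iff_sym.
  by have := base_medial_hedge (g h) (g k); rewrite !gK.
- by rewrite fo -[r1 _]mK -opp_medial_hedge gK.
Qed.

End MedialHalfedges.

(** * Cycle family graphs and medial graphs *)

Section CycleFamilies.

Variables (F : femb) (F4 : regular 4 (underlying F)) (G : embgraph).

(** The bijection onto the flags of a cycle family graph is already a bijection
    onto the half-edges of [F] commuting with [opp].  It sends edges into stars
    because the ends of the arrows with a given label are the half-edges of a
    star, and 4-regularity leaves no room for more. *)
Lemma cycle_family_medial :
  cycle_family F4 G -> graph_iso (underlying (medial G)) (underlying F).
Proof.
case=> s [f [fbij f0 f1 f2 iso]]; apply/medial_isoP.
have b0 x : base (f (r0 x) : hedge (underlying F)) = base (f x).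
  by rewrite f0; have [] := side_prop (P := state_arrows F4 s) (f x).
have b2 x : base (f (r2 x) : hedge (underlying F)) = base (f x).
  by rewrite f2; exact: pairing_base.
have bE x y : y \in edge_flags x ->
    base (f y : hedge (underlying F)) = base (f x).
  by rewrite !inE => /or4P[]/eqP->; rewrite ?b0 ?b2.
exists f; split=> // [x y|w].
- split=> [bxy|exy]; last by rewrite (@bE y x) // -exy edge_flags_refl.
  (* The flags of an edge are sent into a star; both have four elements. *)
  have star : f @: edge_flags x =
      [set h : hedge (underlying F) | base h == base (f x)].
    apply/eqP; rewrite eqEcard card_imset ?card_edge_flags; last exact: bij_inj.
    apply/andP; split; last by have := F4 (base (f x)); rewrite /degree => ->.
    by apply/subsetP=> _ /imsetP[z zx ->]; rewrite inE (bE x).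
  have : f y \in f @: edge_flags x by rewrite star inE bxy.
  by rewrite (mem_imset _ _ (bij_inj fbij)) edge_flagsE => /eqP.
- have : 0 < degree w by rewrite F4.
  by rewrite /degree card_gt0 => /set0Pn[h]; rewrite inE => hw; exists h.
Qed.

(** The marked state is read off the ribbon graph [G]: its pairing is [r2] and
    its arrows point to the heads chosen by [arrow_head].  The free sides of
    the resulting edge discs are then forced to be [r0]. *)
Lemma medial_cycle_family :
  graph_iso (underlying (medial G)) (underlying F) -> cycle_family F4 G.
Proof.
case/medial_isoP=> f [fbij fo fb _ iso]; have [g fK gK] := fbij.
have pK : involutive (fun h => f (r2 (g h))).
  by move=> h; rewrite fK r2K gK.
have p_neq h : f (r2 (g h)) != h.
  by rewrite -{2}(gK h) (inj_eq (bij_inj fbij)) r2_neq.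
have p_base h : base (f (r2 (g h))) = base h.
  by rewrite -{2}(gK h); apply/fb/edge_flags_r2.
have p_head h : arrow_head (g (f (r2 (g h)))) = ~~ arrow_head (g h).
  by rewrite fK arrow_head_r2.
pose s := MarkedState pK p_neq p_base p_head.
exists s, f; split=> // x.
- apply/eqP; rewrite -(@sideP (state_arrows F4 s)) /sidepred /=.
  rewrite !fK arrow_head_r0 eqxx (inj_eq (bij_inj fbij)) r02_neq !andbT.
  by apply/eqP/fb/edge_flags_r0.
- exact/esym/fo.
- by rewrite /= fK.
Qed.

End CycleFamilies.

Theorem theorem4p14 :
  forall (F : mgraph) (F4 : regular 4 F) (Ft : femb)
         (FtF : graph_iso (underlying Ft) F),
  (forall G : embgraph,
     cycle_family (regular_iso FtF F4) G <->
     graph_iso (underlying (medial G)) (underlying Ft)) /\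
  (forall G : embgraph,
     graph_iso (underlying (medial G)) (underlying Ft) <->
     graph_iso (underlying (medial G)) F).
Proof.
move=> F F4 Ft FtF; split=> G; split.
- exact: cycle_family_medial.
- exact: medial_cycle_family.
- by move=> GFt; apply: graph_iso_trans FtF.
- by move=> GF; apply: graph_iso_trans (graph_iso_sym FtF).
Qed.
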